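(* Let $P$ be a finite non-empty poset and $p$ the number of filters of $P$. Let $(L^P, \alpha)$ be a multi-semilattice where $L$ is a finite meet-semilattice with no greatest member, and let $n \geq 1$ be an integer. If for every join-irreducible $a \in L$, $\left|L^P \setminus [a)^P\right|_\alpha \leq n$, then $\left|L^P\right|_\alpha \leq M^{\circ}(n)$, where $$M^{\circ}(n) = \max\{kn - p^{k-1}(k(p-1) - p) + (k-1)\delta_k - k\delta_{k-1} \mid k \geq 2 \text{ an integer and } p^{k-1}(p-1) - \delta_k + \delta_{k-1} \leq n\}$$ (with $\max \emptyset = 0$). This bound is best possible: for every $P$ and every $n$ for which the set being maximized is non-empty, there exist $L$ and $\alpha$ satisfying the hypotheses with $\left|L^P\right|_\alpha = M^{\circ}(n)$.
   Context: For posets $P$ and $Q$, $Q^P$ is the set of order-preserving maps from $P$ to $Q$, ordered pointwise. For $a\in L$, $[a) = \{u \in L \mid u \geq a\}$, and $[a)^P \subseteq L^P$ is the set of order-preserving maps from $P$ into $[a)$. In a meet-semilattice an element $a$ is join-irreducible iff it covers at most one element. A filter of $P$ is an up-closed subset (possibly empty). A multi-semilattice $(K,\alpha)$ consists of a meet-semilattice $K$ and a function $\alpha : K \to \{1,2,3,\dots\}$; for $S \subseteq K$, $|S|_\alpha = \sum_{u \in S} \alpha(u)$. For $k \geq 1$, $B_k$ is the Boolean lattice of subsets of a $k$-element set, $B_k^{\circ} = B_k \setminus \{\hat{1}\}$, and $\delta_k = \left|B_k^P \setminus (B_k^{\circ})^P\right|$. *)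

(* Defs.v *)
From HB Require Import structures.
From mathcomp Require Import all_boot all_order all_algebra.

Set Implicit Arguments.
Unset Strict Implicit.
Unset Printing Implicit Defensive.

Import Order.TTheory GRing.Theory Num.Theory.
Import Order.DefaultSetSubsetOrder.

Local Open Scope order_scope.

(* [ordmap P Q] is Q^P. *)
Section OrderMaps.

Context {dP dQ : Order.disp_t}.

Record ordmap (P : finPOrderType dP) (Q : finPOrderType dQ) := OrdMap {
  ordmap_fun :> {ffun P -> Q};
  _ : [forall x, forall y, (x <= y) ==> (ordmap_fun x <= ordmap_fun y)]
}.

HB.instance Definition _ P Q := [isSub for @ordmap_fun P Q].
HB.instance Definition _ P Q := [Finite of ordmap P Q by <:].

Section PointwiseOrder.

Variables (P : finPOrderType dP) (Q : finPOrderType dQ).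
Implicit Types f g h : ordmap P Q.

Lemma ordmap_homo f : {homo f : x y / x <= y}.
Proof. by move=> x y; move: (valP f) => /forallP/(_ x)/forallP/(_ y)/implyP. Qed.

Lemma ordmapP f g : f =1 g -> f = g.
Proof. by move=> fg; apply/val_inj/ffunP. Qed.

Definition ordmap_le f g := [forall x, f x <= g x].

Fact ordmap_le_refl : reflexive ordmap_le.
Proof. by move=> f; apply/forallP => x. Qed.

Fact ordmap_le_trans : transitive ordmap_le.
Proof.
move=> g f h /forallP fg /forallP gh; apply/forallP => x.
exact: le_trans (fg x) (gh x).
Qed.

Fact ordmap_le_anti : antisymmetric ordmap_le.
Proof.
move=> f g /andP[/forallP fg /forallP gf]; apply: ordmapP => x.
by apply/le_anti; rewrite fg gf.
Qed.

HB.instance Definition _ :=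
  Order.Le_isPOrder.Build dQ (ordmap P Q)
    ordmap_le_refl ordmap_le_anti ordmap_le_trans.

End PointwiseOrder.

Section PointwiseMeet.

Variables (P : finPOrderType dP) (L : finMeetSemilatticeType dQ).
Implicit Types f g h : ordmap P L.

Fact ordmap_meet_subproof f g :
  let m : {ffun P -> L} := [ffun x => f x `&` g x] in
  [forall x, forall y, (x <= y) ==> (m x <= m y)].
Proof.
apply/forallP => x; apply/forallP => y; apply/implyP => xy.
by rewrite !ffunE leI2 ?ordmap_homo.
Qed.

Definition ordmap_meet f g : ordmap P L := OrdMap (ordmap_meet_subproof f g).

Fact ordmap_meetC : commutative ordmap_meet.
Proof. by move=> f g; apply: ordmapP => x; rewrite !ffunE meetC. Qed.

Fact ordmap_meetA : associative ordmap_meet.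
Proof. by move=> f g h; apply: ordmapP => x; rewrite !ffunE meetA. Qed.

Fact ordmap_leEmeet f g : (f <= g) = (ordmap_meet f g == f).
Proof.
apply/forallP/eqP => [fg|fg x].
  by apply: ordmapP => x; rewrite ffunE; apply/meet_idPl.
by rewrite -{1}fg ffunE leIr.
Qed.

HB.instance Definition _ :=
  Order.POrder_Meet_isSemilattice.Build dQ (ordmap P L)
    ordmap_meetC ordmap_meetA ordmap_leEmeet.

End PointwiseMeet.

(* S^P as a subset of Q^P, for S a subset of Q. *)
Definition maps_into (P : finPOrderType dP) (Q : finPOrderType dQ)
    (S : {set Q}) : {set ordmap P Q} :=
  [set f : ordmap P Q | [forall x, f x \in S]].

End OrderMaps.

Arguments maps_into {dP dQ} P {Q} S.

Section Posets.

Context {d : Order.disp_t}.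

(* [a) *)
Definition upper (L : finPOrderType d) (a : L) : {set L} :=
  [set u | a <= u].

Definition covers (L : finPOrderType d) (a b : L) : bool :=
  (b < a) && ~~ [exists c, (b < c) && (c < a)].

(* The least element, which covers nothing, counts as join-irreducible. *)
Definition join_irreducible (L : finMeetSemilatticeType d) (a : L) : bool :=
  (#|[set b | covers a b]| <= 1)%N.

Definition no_greatest (L : finPOrderType d) : Prop :=
  ~ exists t : L, forall x, x <= t.

Definition is_filter (P : finPOrderType d) (F : {set P}) : bool :=
  [forall x in F, forall y, (x <= y) ==> (y \in F)].

Definition nfilters (P : finPOrderType d) : nat :=
  #|[set F : {set P} | is_filter F]|.

(* (K, alpha) is a multi-semilattice. *)
Definition multi_semilattice (K : finMeetSemilatticeType d)
    (alpha : K -> nat) : Prop :=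
  forall u, (0 < alpha u)%N.

(* |S|_alpha *)
Definition multi_card (K : finMeetSemilatticeType d)
    (alpha : K -> nat) (S : {set K}) : nat :=
  (\sum_(u in S) alpha u)%N.

(* delta_k. B_k is {set 'I_k} with its inclusion order, so its greatest
   element is setT. *)
Definition delta (P : finPOrderType d) (k : nat) : nat :=
  #|[set: ordmap P {set 'I_k}] :\: maps_into P [set~ [set: 'I_k]]|.

End Posets.

Local Open Scope ring_scope.

(* The set being maximized in the definition of M°(n). *)
Definition Mcirc_set {d : Order.disp_t} (P : finPOrderType d) (n : nat)
    (v : int) : Prop :=
  let p := (nfilters P)%:Z in
  let del k := (delta P k)%:Z in
  exists k : nat,
    [/\ (2 <= k)%N,
        p ^+ k.-1 * (p - 1) - del k + del k.-1 <= n%:Z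
      & v = k%:Z * n%:Z - p ^+ k.-1 * (k%:Z * (p - 1) - p)
            + (k%:Z - 1) * del k - k%:Z * del k.-1].

(* M = max S, with the convention that the maximum of the empty set is 0.
   A relation, because the existence of the maximum is a matter of proof. *)
Definition is_max0 (S : int -> Prop) (M : int) : Prop :=
  (S M /\ forall v, S v -> v <= M) \/ ((forall v, ~ S v) /\ M = 0).

Definition is_Mcirc {d : Order.disp_t} (P : finPOrderType d) (n : nat)
    (M : int) : Prop :=
  is_max0 (Mcirc_set P n) M.

(* Main.v *)
(* Write C_k = |(B_k°)^P|; then C_k = p^k - delta_k, and n and k enter M°(n)
   only through the condition D_k := C_k - C_{k-1} <= n and the value
   k (n - D_k) + C_k.  Here D_k counts the maps P -> B_k° not landing in [a),
   for any atom a; as D_k >= k, only finitely many k compete.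

   If L has no greatest element, its join-irreducibles have no common upper
   bound, so there is a minimal unbounded set {a_1, ..., a_k} of them.  The map
   f |-> (x |-> {i | a_i <= f x}) from L^P to (B_k°)^P has a section: with t_j
   an upper bound of the a_i for i <> j, send a proper subset A to the meet of
   the t_j for j not in A.  A map f lies outside [a_i)^P for exactly c(f) >= 1
   indices i, so the sum of alpha(f) c(f) is at most k n, while by the section
   the sum of alpha(f) (c(f) - 1) is at least that of c - 1 over (B_k°)^P,
   which is k D_k - C_k.  Subtracting gives |L^P|_alpha <= k (n - D_k) + C_k.

   Equality holds for L = B_k° when alpha is 1, raised by n - D_k at each
   constant map to a coatom: such a map lies outside [a)^P for one atom a. *)

From HB Require Import structures.
Require Import Defs.
From mathcomp Require Import all_boot all_order all_algebra.
From mathcomp Require Import zify ring.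

Set Implicit Arguments.
Unset Strict Implicit.
Unset Printing Implicit Defensive.

Import Order.TTheory GRing.Theory Num.Theory.
Import Order.DefaultSetSubsetOrder.

(** * The meet-semilattice of proper subsets of ['I_k] *)

Section PuncturedBoolean.

Local Open Scope order_scope.

Record bcirc (k : nat) := Bcirc {
  bcirc_set :> {set 'I_k};
  _ : bcirc_set != [set: 'I_k]
}.

HB.instance Definition _ k := [isSub for @bcirc_set k].
HB.instance Definition _ k := [Finite of bcirc k by <:].
HB.instance Definition _ k :=
  [SubChoice_isSubPOrder of bcirc k by <: with Order.Disp tt tt].

Variable k : nat.
Implicit Types A B C : bcirc k.

Lemma bcirc_leE A B : (A <= B) = (bcirc_set A \subset bcirc_set B).
Proof. by rewrite leEsub Order.SetSubsetOrder.leEsubset. Qed.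

Lemma bcirc_neqT A : bcirc_set A != [set: 'I_k].
Proof. exact: valP A. Qed.

Fact bcirc_meet_subproof A B : bcirc_set A :&: bcirc_set B != [set: 'I_k].
Proof.
apply: contraNneq (bcirc_neqT A) => AB.
by rewrite -subTset -AB subsetIl.
Qed.

Definition bcirc_meet A B := Bcirc (bcirc_meet_subproof A B).

Fact bcirc_meetC : commutative bcirc_meet.
Proof. by move=> A B; apply/val_inj; rewrite /= setIC. Qed.

Fact bcirc_meetA : associative bcirc_meet.
Proof. by move=> A B C; apply/val_inj; rewrite /= setIA. Qed.

Fact bcirc_leEmeet A B : (A <= B) = (bcirc_meet A B == A).
Proof. by rewrite bcirc_leE -val_eqE; apply/setIidPl/eqP. Qed.

End PuncturedBoolean.

HB.instance Definition _ k :=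
  Order.POrder_Meet_isSemilattice.Build (Order.Disp tt tt) (bcirc k)
    (@bcirc_meetC k) (@bcirc_meetA k) (@bcirc_leEmeet k).

(** * Composites and constants among order-preserving maps *)

Section OrderMapConstructions.

Local Open Scope order_scope.

Fact ordmap_of_subproof (dP dQ : Order.disp_t) (P : finPOrderType dP)
    (Q : finPOrderType dQ) (f : P -> Q) : {homo f : x y / x <= y} ->
  let m : {ffun P -> Q} := finfun f in
  [forall x, forall y, (x <= y) ==> (m x <= m y)].
Proof.
move=> hf; apply/forallP => x; apply/forallP => y; apply/implyP => xy.
by rewrite !ffunE hf.
Qed.

Definition ordmap_of (dP dQ : Order.disp_t) (P : finPOrderType dP)
    (Q : finPOrderType dQ) (f : P -> Q) (hf : {homo f : x y / x <= y}) :
  ordmap P Q := OrdMap (ordmap_of_subproof hf).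

Lemma ordmap_ofE (dP dQ : Order.disp_t) (P : finPOrderType dP)
    (Q : finPOrderType dQ) (f : P -> Q) (hf : {homo f : x y / x <= y}) :
  ordmap_of hf =1 f.
Proof. by move=> x; rewrite /= ffunE. Qed.

Lemma ordmap_comp_homo (dP dQ dR : Order.disp_t) (P : finPOrderType dP)
    (Q : finPOrderType dQ) (R : finPOrderType dR)
    (h : Q -> R) (f : ordmap P Q) :
  {homo h : x y / x <= y} -> {homo h \o f : x y / x <= y}.
Proof. by move=> hh x y xy; apply/hh/ordmap_homo. Qed.

Definition ordmap_comp (dP dQ dR : Order.disp_t) (P : finPOrderType dP)
    (Q : finPOrderType dQ) (R : finPOrderType dR)
    (h : Q -> R) (hh : {homo h : x y / x <= y}) (f : ordmap P Q) : ordmap P R :=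
  ordmap_of (ordmap_comp_homo f hh).

Lemma ordmap_compE (dP dQ dR : Order.disp_t) (P : finPOrderType dP)
    (Q : finPOrderType dQ) (R : finPOrderType dR)
    (h : Q -> R) (hh : {homo h : x y / x <= y}) (f : ordmap P Q) :
  ordmap_comp hh f =1 h \o f.
Proof. exact: ordmap_ofE. Qed.

Lemma ordmap_comp_inj (dP dQ dR : Order.disp_t) (P : finPOrderType dP)
    (Q : finPOrderType dQ) (R : finPOrderType dR)
    (h : Q -> R) (hh : {homo h : x y / x <= y}) :
  injective h -> injective (@ordmap_comp dP dQ dR P Q R h hh).
Proof.
move=> hi f g fg; apply: ordmapP => x.
move: (congr1 (fun u : ordmap P R => u x) fg); rewrite !ordmap_compE.
exact: hi.
Qed.

Lemma ordmap_const_homo (dP dQ : Order.disp_t) (P : finPOrderType dP)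
    (Q : finPOrderType dQ) (q : Q) : {homo (fun _ : P => q) : x y / x <= y}.
Proof. by []. Qed.

Definition ordmap_const (dP dQ : Order.disp_t) (P : finPOrderType dP)
    (Q : finPOrderType dQ) (q : Q) : ordmap P Q :=
  ordmap_of (@ordmap_const_homo dP dQ P Q q).

End OrderMapConstructions.

(** * The numbers p^k, C_k and D_k *)

Section Counting.

Local Open Scope order_scope.

Variables (dP : Order.disp_t) (P : finPOrderType dP).

(** An order-preserving map [f] into subsets of ['I_k] amounts to a free choice of k filters, the
    i-th being the set of [x] with [i \in f x]. *)
Lemma card_ordmap_set (k : nat) :
  #|{: ordmap P {set 'I_k}}| = (nfilters P ^ k)%N.
Proof.
have hF (f : ordmap P {set 'I_k}) i : is_filter [set x | i \in f x].
  apply/forall_inP => x; rewrite inE => ix; apply/forallP => y.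
  apply/implyP => /(ordmap_homo f); rewrite Order.SetSubsetOrder.leEsubset inE.
  by move=> /subsetP/(_ i ix).
pose F f : {ffun 'I_k -> {F : {set P} | is_filter F}} :=
  [ffun i => exist (fun F => is_filter F) _ (hF f i)].
have hG (u : {ffun 'I_k -> {F : {set P} | is_filter F}}) :
    {homo (fun x => [set i | x \in val (u i)]) : x y / x <= y}.
  move=> x y xy; rewrite Order.SetSubsetOrder.leEsubset; apply/subsetP => i.
    rewrite !inE => ix.
  by move: (valP (u i)) => /forall_inP/(_ x ix)/forallP/(_ y)/implyP/(_ xy).
have FK : cancel F (fun u => ordmap_of (hG u)).
  move=> f; apply: ordmapP => x; rewrite ordmap_ofE.
  by apply/setP => i; rewrite !inE ffunE; rewrite ?inE.
have GK : cancel (fun u => ordmap_of (hG u)) F.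
  move=> u; apply/ffunP => i; rewrite ffunE; apply/val_inj => /=.
  by apply/setP => x; rewrite inE ffunE inE.
have bF : bijective F by exists (fun u => ordmap_of (hG u)).
rewrite (bij_eq_card bF) card_ffun card_ord card_sig.
by congr (_ ^ _)%N; apply: eq_card => A; rewrite !inE.
Qed.

Lemma bcirc_set_homo k : {homo @bcirc_set k : A B / A <= B}.
Proof. by move=> A B; rewrite bcirc_leE Order.SetSubsetOrder.leEsubset. Qed.

(** Composing with the inclusion identifies these maps with the maps into all subsets that never
    take the value [setT]; [delta] counts the others. *)
Lemma card_ordmap_bcirc (k : nat) :
  (#|{: ordmap P (bcirc k)}| + delta P k = nfilters P ^ k)%N.
Proof.
rewrite -card_ordmap_set /delta -[RHS]cardsT.
rewrite -(cardsID (maps_into P [set~ [set: 'I_k]]) setT).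
congr (_ + _)%N.
rewrite setTI -cardsT -(card_imset _ (ordmap_comp_inj
  (hh := @bcirc_set_homo k) (@val_inj _ _ (bcirc k)))).
apply: eq_card => f; rewrite !inE; apply/imsetP/forallP => [[g _ ->] x|hf].
  by rewrite ordmap_compE !inE bcirc_neqT.
have fT x : f x != [set: 'I_k] by move: (hf x); rewrite !inE.
have hg : {homo (fun x => Bcirc (fT x)) : x y / x <= y}.
  by move=> x y /(ordmap_homo f); rewrite bcirc_leE.
exists (ordmap_of hg) => //; apply: ordmapP => x.
by rewrite ordmap_compE [RHS]/comp ordmap_ofE.
Qed.

Fact bcirc_lift_subproof k (i : 'I_k) (A : bcirc k.-1) :
  i |: lift i @: bcirc_set A != [set: 'I_k].
Proof.
apply: contraNneq (bcirc_neqT A) => /setP iA; apply/eqP/setP => j.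
move: (iA (lift i j)); rewrite !inE eq_sym (negPf (neq_lift i j)) /=.
by rewrite mem_imset //; apply: lift_inj.
Qed.

(** Embeds the proper subsets of a (k-1)-element set as the proper subsets of ['I_k] containing [i]:
    [lift i] skips [i], which is then added. *)
Definition bcirc_lift k (i : 'I_k) (A : bcirc k.-1) : bcirc k :=
  Bcirc (bcirc_lift_subproof i A).

Lemma bcirc_lift_inj k (i : 'I_k) : injective (bcirc_lift i).
Proof.
move=> A B [] /setP AB; apply/val_inj/setP => j.
move: (AB (lift i j)); rewrite !inE eq_sym (negPf (neq_lift i j)) /=.
by rewrite !mem_imset //; apply: lift_inj.
Qed.

Lemma bcirc_lift_homo k (i : 'I_k) : {homo bcirc_lift i : A B / A <= B}.
Proof. by move=> A B; rewrite !bcirc_leE => AB; rewrite /= setUS ?imsetS. Qed.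

(** Composition with [bcirc_lift i] is a bijection onto these maps, inverted by pulling values back
    along [lift i]. *)
Lemma card_ordmap_above k (i : 'I_k) :
  #|[set f : ordmap P (bcirc k) | [forall x, i \in bcirc_set (f x)]]| =
  #|{: ordmap P (bcirc k.-1)}|.
Proof.
rewrite -[RHS]cardsT -(card_imset _ (ordmap_comp_inj
  (hh := @bcirc_lift_homo k i) (@bcirc_lift_inj k i))).
apply: eq_card => f; rewrite !inE; apply/forallP/imsetP => [hf|[g _ ->] x].
  have dropE x : i |: lift i @: (lift i @^-1: bcirc_set (f x)) = f x.
    apply/setP => j; rewrite !inE; case: (unliftP i j) => [j'|] ->.
      rewrite mem_imset ?inE; last exact: lift_inj.
      by rewrite eq_sym (negPf (neq_lift i j')).
    by rewrite eqxx (hf x).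
  have dropT x : lift i @^-1: bcirc_set (f x) != setT.
    apply: contraNneq (bcirc_neqT (f x)) => fT; rewrite -dropE fT.
    apply/eqP/setP => j; rewrite !inE.
    by case: (unliftP i j) => [j'|] ->; rewrite ?eqxx // imset_f ?orbT.
  have hg : {homo (fun x => Bcirc (dropT x)) : x y / x <= y}.
    move=> x y xy; rewrite bcirc_leE /= preimsetS //.
    by rewrite -bcirc_leE ordmap_homo.
  exists (ordmap_of hg) => //; apply: ordmapP => x; apply/val_inj.
  by rewrite ordmap_compE [X in _ = val X]/comp ordmap_ofE /= dropE.
by rewrite ordmap_compE setU11.
Qed.

(** This is D_k = C_k - C_{k-1}, in additive form to avoid truncated subtraction. *)
Lemma card_ordmap_not_above k (i : 'I_k) :
  (#|[set f : ordmap P (bcirc k) | ~~ [forall x, i \in bcirc_set (f x)]]| +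
   #|{: ordmap P (bcirc k.-1)}| = #|{: ordmap P (bcirc k)}|)%N.
Proof.
rewrite -(card_ordmap_above i) addnC -[RHS]cardsT.
rewrite -(cardsID [set f : ordmap P (bcirc k) |
  [forall x, i \in bcirc_set (f x)]] setT) setTI.
by congr (_ + _)%N; apply: eq_card => f; rewrite !inE andbT.
Qed.

(* The constant maps at {j} for j != i, and at the empty set for j = i. *)
Lemma leq_card_ordmap_not_above k (i : 'I_k) : (0 < #|P|)%N ->
  (k <= #|[set f : ordmap P (bcirc k) |
             ~~ [forall x, i \in bcirc_set (f x)]]|)%N.
Proof.
move=> /card_gt0P [x0 _].
have hT (j : 'I_k) : [set j] :\ i != setT.
  by apply/eqP => /setP/(_ i); rewrite !inE eqxx.
pose c j := ordmap_const P (Bcirc (hT j)).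
have cE j x : bcirc_set (c j x) = [set j] :\ i by rewrite ordmap_ofE.
have c_inj : injective c.
  move=> j j' /(congr1 (fun u : ordmap P (bcirc k) => bcirc_set (u x0))).
  rewrite !cE => /setP E; have := E j; have := E j'; rewrite !inE !eqxx !andbT.
  rewrite (eq_sym j'); case: (eqVneq j j') => // _; rewrite !andbF.
  case: eqVneq => // -> _; case: eqVneq => //.
rewrite -[X in (X <= _)%N]card_ord -cardsT -(card_imset _ c_inj).
apply/subset_leq_card/subsetP => _ /imsetP [j _ ->].
by rewrite inE; apply/forallPn; exists x0; rewrite cE !inE eqxx.
Qed.

End Counting.

(** * Minimal unbounded families of join-irreducibles *)

Section UnboundedFamilies.

Local Open Scope order_scope.

Variables (dL : Order.disp_t) (L : finMeetSemilatticeType dL).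

(** Induction on the number of elements below [x]. If [x] is not join-irreducible, it covers two
    distinct elements, both below [t] by induction; were [x] not below [t], each would equal the
    meet of [t] and [x]. *)
Lemma join_irreducible_generate (t : L) :
  (forall a, join_irreducible a -> a <= t) -> forall x, x <= t.
Proof.
move=> tP x; have [m] := ubnP #|[set y | y < x]|.
elim: m x => // m IHm x /ltnSE xm.
have [/tP //|] := boolP (join_irreducible x).
rewrite /join_irreducible -ltnNge => /card_gt1P [b [c []]].
rewrite !inE => xb xc bc.
have below y : covers x y -> y <= t.
  move=> /andP[yx _]; apply/IHm/(leq_trans _ xm)/proper_card/properP; split.
    by apply/subsetP => z; rewrite !inE => /lt_trans; apply.
  by exists y; rewrite !inE ?ltxx.
have coverI y : covers x y -> ~~ (x <= t) -> t `&` x = y.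
  move=> xy xt; move: (xy) => /andP[yx /existsPn/(_ (t `&` x))].
  rewrite negb_and !lt_neqAle !leIr !lexI below // (ltW yx) /= !andbT !negbK.
  by case/orP => /eqP // tx; rewrite -tx leIl in xt.
apply: contraNT bc => xt; apply/eqP.
by rewrite -(coverI b) // -(coverI c).
Qed.

(** [a] enumerates an inclusion-minimal unbounded set of join-irreducibles, and [t j] bounds what
    remains of it without [a j]. *)
Lemma exists_minimal_unbounded : no_greatest L -> (0 < #|L|)%N ->
  exists k (a t : 'I_k -> L),
    [/\ (2 <= k)%N, forall i, join_irreducible (a i),
        forall u, exists i, ~~ (a i <= u)
      & forall i j, i != j -> a i <= t j].
Proof.
move=> noT /card_gt0P [x0 _].
pose bounded (A : {set L}) := [exists u, [forall a in A, a <= u]].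
pose J := [set a : L | join_irreducible a].
have [A minA AJ] : {A | minset (fun A => ~~ bounded A) A & A \subset J}.
  apply: minset_exists; apply/existsP => -[u /forall_inP uP]; apply: noT.
  by exists u; apply: join_irreducible_generate => a ja; apply: uP; rewrite inE.
have [/existsPn unbA minA'] := minsetP minA.
have unb u : exists i : 'I_#|A|, ~~ (enum_val i <= u).
  move: (unbA u); rewrite negb_forall_in => /exists_inP [a aA au].
  by exists (enum_rank_in aA a); rewrite enum_rankK_in.
have [t tP] : exists t : 'I_#|A| -> L,
    forall j i, i != j -> enum_val i <= t j.
  apply: (@fin_all_exists _ _
    (fun j u => forall i, i != j -> enum_val i <= u)) => j.
  have /existsP [u /forall_inP uP] : bounded (A :\ enum_val j).
    apply: contraT => /minA'/(_ (subD1set _ _))/setP/(_ (enum_val j)).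
    by rewrite !inE eqxx enum_valP.
  exists u => i ij; apply: uP; rewrite !inE enum_valP andbT.
  by apply: contra_neq ij; apply: enum_val_inj.
exists #|A|, enum_val, t; split=> //.
(* At least two members: a single element bounds itself, and [x0] bounds the empty set. *)
- rewrite leqNgt; apply/negP => /ltnSE; rewrite leq_eqVlt ltnS leqn0.
  case/orP => [/cards1P [a Aa]|/eqP/cards0_eq A0].
    have [i] := unb a; have /setP/(_ (enum_val i)) := Aa.
    by rewrite enum_valP inE => /esym/eqP ->; rewrite lexx.
  have [i _] := unb x0; have /setP/(_ (enum_val i)) := A0.
  by rewrite enum_valP inE.
- by move=> i; move/subsetP: AJ => /(_ _ (enum_valP i)); rewrite inE.
- by move=> i j ij; apply: tP.
Qed.

(** [h A] is the meet of the [t j] for [j] outside [A], and [a i] lies below [t j] exactly when [i]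
    differs from [j]. *)
Lemma exists_bcirc_section k (a t : 'I_k -> L) :
    (forall u, exists i, ~~ (a i <= u)) ->
    (forall i j, i != j -> a i <= t j) ->
  exists h : bcirc k -> L, {homo h : A B / A <= B} /\
    forall A i, (a i <= h A) = (i \in bcirc_set A).
Proof.
move=> unb at_; have at_E i j : (a i <= t j) = (i != j).
  have [<-|/at_ ->//] := eqVneq i j; apply/negP => ait.
  have [i'] := unb (t i); apply/negP; rewrite negbK.
  by have [->//|/at_] := eqVneq i' i.
have [h hP] : exists h : bcirc k -> L, forall A y,
    (y <= h A) = [forall i in ~: bcirc_set A, y <= t i].
  apply: (@fin_all_exists _ _ (fun A m => forall y,
    (y <= m) = [forall i in ~: bcirc_set A, y <= t i])) => A.
  have [i0 Ai0] : exists i0, i0 \in ~: bcirc_set A.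
    by apply/set0Pn; rewrite -setCT (inj_eq (@setC_inj _)) bcirc_neqT.
  (* The iterated meet needs a starting value in place of a top element; [t i0] is one of the
     factors, so it changes nothing. *)
  exists (\big[Order.meet/t i0]_(i in ~: bcirc_set A) t i) => y.
  have -> : (y <= \big[Order.meet/t i0]_(i in ~: bcirc_set A) t i) =
      (y <= t i0) && [forall i in ~: bcirc_set A, y <= t i].
    rewrite -big_andE.
    apply: (big_rec2 (fun m b => (y <= m) = (y <= t i0) && b)).
      by rewrite andbT.
    by move=> i b m _ mb; rewrite lexI mb andbCA.
  by apply: andb_idl => /forall_inP; apply.
exists h; split=> [A B|A i].
  rewrite bcirc_leE => /subsetP AB; rewrite hP; apply/forall_inP => i iB.
  have : [forall i in ~: bcirc_set A, h A <= t i] by rewrite -hP.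
  by move=> /forall_inP; apply; move: iB; rewrite !inE; apply: contra => /AB.
rewrite hP; apply/forall_inP/idP => [hA|iA j].
  by apply: contraTT isT => iA; move: (hA i); rewrite inE at_E eqxx => /(_ iA).
by rewrite inE at_E; apply: contraNneq => <-.
Qed.

End UnboundedFamilies.

(** * The upper bound, by weighted double counting *)

Section UpperBound.

Local Open Scope order_scope.

(** Group the terms by [phi t]: the fibre over [u] contains [psi u], whose term alone is at least
    [w u] as [alpha] is positive. *)
Lemma leq_sum_section (T U : finType) (phi : T -> U) (psi : U -> T)
    (alpha : T -> nat) (w : U -> nat) :
    cancel psi phi -> (forall t, (0 < alpha t)%N) ->
  (\sum_u w u <= \sum_t alpha t * w (phi t))%N.
Proof.
move=> psiK alpha0; rewrite [X in (_ <= X)%N](partition_big phi predT) //=.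
apply: leq_sum => u _; rewrite (bigD1 (psi u)) ?psiK //=.
by apply: leq_trans (leq_addr _ _); rewrite leq_pmull.
Qed.

Variables (dP dL : Order.disp_t) (P : finPOrderType dP).
Variables (L : finMeetSemilatticeType dL) (alpha : ordmap P L -> nat) (n : nat).
Hypothesis P0 : (0 < #|P|)%N.
Hypothesis alpha0 : multi_semilattice alpha.
Hypothesis noT : no_greatest L.
Hypothesis alpha_le : forall a : L, join_irreducible a ->
  (multi_card alpha ([set: ordmap P L] :\: maps_into P (upper a)) <= n)%N.

Lemma multi_card_le : (0 < #|L|)%N ->
  exists k, [/\ (2 <= k)%N,
    (#|{: ordmap P (bcirc k)}| <= n + #|{: ordmap P (bcirc k.-1)}|)%N &
    (multi_card alpha setT <=
       k * (n + #|{: ordmap P (bcirc k.-1)}| - #|{: ordmap P (bcirc k)}|) +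
       #|{: ordmap P (bcirc k)}|)%N].
Proof.
move=> /(exists_minimal_unbounded noT) [k [a [t [k2 ja unb at_]]]].
have [h [h_homo hP]] := exists_bcirc_section unb at_.
have traceT u : [set i | a i <= u] != setT.
  have [i au] := unb u; apply: contraNneq au => /setP/(_ i).
  by rewrite !inE.
have trace_homo : {homo (fun u => Bcirc (traceT u)) : u v / u <= v}.
  move=> u v uv; rewrite bcirc_leE; apply/subsetP => i; rewrite !inE => au.
  exact: le_trans uv.
pose phi : ordmap P L -> ordmap P (bcirc k) := ordmap_comp trace_homo.
have psiK : cancel (ordmap_comp h_homo : ordmap P (bcirc k) -> _) phi.
  move=> g; apply: ordmapP => x; apply/val_inj/setP => i.
  by rewrite ordmap_compE [LHS]inE ordmap_compE; apply: hP.
(* For [g = phi f] this says that [f] lies outside [a_i)^P; summed over [i] it gives the number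
   c(f). *)
pose miss i (g : ordmap P (bcirc k)) := ~~ [forall x, i \in bcirc_set (g x)].
pose D := (#|{: ordmap P (bcirc k)}| - #|{: ordmap P (bcirc k.-1)}|)%N.
have missD i : (\sum_g miss i g = D)%N.
  rewrite /D -(card_ordmap_not_above P i) addnK -sum1_card [RHS]big_mkcond /=.
  by apply: eq_bigr => g _; rewrite inE.
have missE i : (\sum_f alpha f * miss i (phi f) =
    multi_card alpha ([set: ordmap P L] :\: maps_into P (upper (a i))))%N.
  rewrite /multi_card big_mkcond [RHS]big_mkcond /=; apply: eq_bigr => f _.
  rewrite !inE andbT /miss.
  under eq_forallb => x do rewrite ordmap_compE inE.
  under [X in if ~~ X then _ else _]eq_forallb => x do rewrite inE.
  by case: ifP; rewrite ?muln1 ?muln0.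
have miss_le i : (\sum_f alpha f * miss i (phi f) <= n)%N.
  by rewrite missE alpha_le.
pose i0 : 'I_k := Ordinal (leq_trans (isT : (0 < 2)%N) k2).
have Ck : (#|{: ordmap P (bcirc k)}| = D + #|{: ordmap P (bcirc k.-1)}|)%N.
  by rewrite /D -(card_ordmap_not_above P i0) addnK.
(* The section carries the [D] maps missing [i0] injectively into the maps whose total weight the
   hypothesis on [a i0] bounds by [n]. *)
have Dn : (D <= n)%N.
  rewrite -(missD i0); apply: leq_trans (miss_le i0).
  exact: leq_sum_section psiK alpha0.
(* At a point of [P] the value of [g] is a proper subset. Hence c >= 1, and the predecessors in [E]
   and [F] are exact. *)
have miss_gt0 g : (0 < \sum_i miss i g)%N.
  have /card_gt0P [x _] := P0.
  have /existsP [i gi] : [exists i, i \notin bcirc_set (g x)].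
    rewrite -negb_forall; apply: contra (bcirc_neqT (g x)) => /forallP gT.
    by apply/eqP/setP => i; rewrite inE gT.
  rewrite (bigD1 i) //= /miss.
  suff -> : ~~ [forall x, i \in bcirc_set (g x)] by [].
  by apply/forallPn; exists x.
have tot : (\sum_g \sum_i miss i g = k * D)%N.
  rewrite exchange_big /=; under eq_bigr do rewrite missD.
  by rewrite sum_nat_const card_ord.
have totn : (\sum_f alpha f * \sum_i miss i (phi f) <= k * n)%N.
  under eq_bigr do rewrite big_distrr /=.
  rewrite exchange_big /=; apply: (@leq_trans (\sum_(i < k) n)).
    by apply: leq_sum => i _; apply: miss_le.
  by rewrite sum_nat_const card_ord.
pose E := (\sum_g (\sum_i miss i g).-1)%N.
pose F := (\sum_f alpha f * (\sum_i miss i (phi f)).-1)%N.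
have EF : (E <= F)%N.
  exact: leq_sum_section (fun g => (\sum_i miss i g).-1) psiK alpha0.
have kDE : (k * D = E + (D + #|{: ordmap P (bcirc k.-1)}|))%N.
  rewrite -tot -Ck -sum1_card -big_split /=; apply: eq_bigr => g _.
  by rewrite addn1 prednK.
have Fn : (F + multi_card alpha setT <= k * n)%N.
  rewrite /multi_card [X in (_ + X)%N](eq_bigl predT) => [|f].
    rewrite -big_split /=; apply: leq_trans totn; apply: leq_sum => f _.
    by rewrite -[X in (_ + X)%N]muln1 -mulnDr addn1 prednK.
  by rewrite inE.
exists k; split=> //; first by rewrite Ck leq_add2r.
(* By [Fn], [EF] and [kDE] the total is at most k n - E = k (n - D) + C_k; [Dn] makes the truncated
   difference exact. *)
rewrite Ck subnDr mulnBr.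
have : (k * D <= k * n)%N by rewrite leq_mul2l Dn orbT.
lia.
Qed.

End UpperBound.

(** * The extremal example on the punctured Boolean lattice *)

Section Sharpness.

Local Open Scope order_scope.

Variables (dP : Order.disp_t) (P : finPOrderType dP) (k s : nat).

(** For k >= 2 singletons are proper, and a greatest element would contain them all. *)
Lemma bcirc_no_greatest : (2 <= k)%N -> no_greatest (bcirc k).
Proof.
move=> k2 [T TP]; case/negP: (bcirc_neqT T); apply/eqP/setP => i.
rewrite [RHS]inE; have /card_gt1P [j [j' [_ _ jj']]] : (1 < #|'I_k|)%N.
  by rewrite card_ord.
have [l li] : exists l : 'I_k, i != l.
  by have [->|] := eqVneq i j; [exists j' | exists j].
have iT : [set i] != setT.
  by apply: contra_neq li => /setP/(_ l); rewrite !inE => /eqP ->.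
by have := TP (Bcirc iT); rewrite bcirc_leE sub1set.
Qed.

(** A set with two distinct elements covers both sets obtained by deleting one of them. *)
Lemma join_irreducible_bcirc (A : bcirc k) :
  join_irreducible A -> (#|bcirc_set A| <= 1)%N.
Proof.
apply: contraTT; rewrite -!ltnNge => /card_gt1P [i [j [iA jA ij]]].
have DT l : bcirc_set A :\ l != setT.
  by apply/eqP => /setP/(_ l); rewrite !inE eqxx.
have cov l : l \in bcirc_set A -> covers A (Bcirc (DT l)).
  move=> lA; rewrite /covers lt_neqAle bcirc_leE subsetDl andbT -val_eqE /=.
  apply/andP; split.
    by apply/eqP => /setP/(_ l); rewrite !inE eqxx lA.
  apply/existsPn => C; apply/negP => /andP[].
  rewrite !lt_neqAle !bcirc_leE /= => /andP[lC DC] /andP[CA CsA].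
  have [lC'|lC'] := boolP (l \in bcirc_set C).
    have AC : bcirc_set A \subset bcirc_set C.
      by rewrite -(setD1K lA) subUset sub1set lC' DC.
    by move/eqP: CA; apply; apply/val_inj/setP/subset_eqP; rewrite CsA AC.
  move/eqP: lC; apply; apply/val_inj/setP/subset_eqP.
  by rewrite DC subsetD1 CsA.
apply/card_gt1P; exists (Bcirc (DT i)), (Bcirc (DT j)).
rewrite !inE !cov //; split=> //; rewrite -val_eqE /=.
by apply: contra_neq ij => /setP/(_ i); rewrite !inE eqxx iA andbT; case: eqP.
Qed.

Fact bcirc_coatom_subproof (j : 'I_k) : [set~ j] != setT.
Proof. by apply/eqP => /setP/(_ j); rewrite !inE eqxx. Qed.

Definition bcirc_coatom j : bcirc k := Bcirc (bcirc_coatom_subproof j).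

(** Summing over the indices [j] lets each [j] add [s] to the total of any set that contains its
    constant map. *)
Definition coatom_weight (f : ordmap P (bcirc k)) : nat :=
  (1 + s * \sum_j (f == ordmap_const P (bcirc_coatom j)))%N.

Lemma multi_card_coatom_weight (X : {set ordmap P (bcirc k)}) :
  multi_card coatom_weight X =
  (#|X| + s * #|[set j | ordmap_const P (bcirc_coatom j) \in X]|)%N.
Proof.
rewrite /multi_card /coatom_weight big_split /= sum1_card; congr (_ + _)%N.
rewrite -big_distrr /= exchange_big /=; congr (_ * _)%N.
rewrite -sum1_card [RHS]big_mkcond /=; apply: eq_bigr => j _; rewrite inE.
set c := ordmap_const _ _; case: ifP => [cX|cX].
  rewrite (bigD1 c) //= eqxx big1 ?addn0 // => f /andP[_ /negPf ->] //.
by rewrite big1 // => f fX; case: eqP => // fc; rewrite -fc fX in cX.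
Qed.

Lemma multi_card_coatom_weightT :
  multi_card coatom_weight setT = (k * s + #|{: ordmap P (bcirc k)}|)%N.
Proof.
rewrite multi_card_coatom_weight cardsT addnC mulnC; congr (_ * _ + _)%N.
by rewrite -[RHS]card_ord; apply: eq_card => j; rewrite !inE.
Qed.

(** If [A] is {i}, the maps outside [A)^P number D_k and include just one weighted constant, at the
    complement of {i}, so the total is D_k + s. If [A] is empty, no map lies outside. *)
Lemma multi_card_coatom_weight_le (n : nat) (A : bcirc k) : (0 < #|P|)%N ->
    (#|{: ordmap P (bcirc k)}| + s <= n + #|{: ordmap P (bcirc k.-1)}|)%N ->
    join_irreducible A ->
  (multi_card coatom_weight
     ([set: ordmap P (bcirc k)] :\: maps_into P (upper A)) <= n)%N.
Proof.
move=> /card_gt0P [x0 _] sn /join_irreducible_bcirc.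
rewrite multi_card_coatom_weight leq_eqVlt ltnS leqn0.
case/orP => [/cards1P [i Ai]|/eqP/cards0_eq A0].
  rewrite (_ : _ :\: _ = [set f : ordmap P (bcirc k) |
      ~~ [forall x, i \in bcirc_set (f x)]]); last first.
    apply/setP => f; rewrite !inE andbT; congr (~~ _).
    by apply: eq_forallb => x; rewrite inE bcirc_leE Ai sub1set.
  rewrite (_ : [set _ | _] = [set i]) ?cards1; last first.
    apply/setP => j; rewrite !inE; apply/forallPn/eqP => [[x]|<-].
      by rewrite ordmap_ofE !inE negbK eq_sym => /eqP.
    by exists x0; rewrite ordmap_ofE !inE eqxx.
  rewrite muln1; move: sn.
  by rewrite -(card_ordmap_not_above P i) addnAC leq_add2r.
rewrite (_ : _ :\: _ = set0).
  rewrite cards0 (_ : [set _ | _] = set0) ?cards0 ?muln0 //.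
  by apply/setP => j; rewrite !inE.
apply/setP => f; rewrite !inE andbT; apply/negbF/forallP => x.
by rewrite inE bcirc_leE A0 sub0set.
Qed.

End Sharpness.

(** * The maximized set in terms of C_k and D_k *)

Section MaximizedSet.

Variables (dP : Order.disp_t) (P : finPOrderType dP) (n : nat).

Definition admissible (k : nat) : bool :=
  (2 <= k)%N &&
  (#|{: ordmap P (bcirc k)}| <= n + #|{: ordmap P (bcirc k.-1)}|)%N.

(** For admissible [k] the truncated difference is exactly n - D_k. *)
Definition Mcirc_value (k : nat) : nat :=
  (k * (n + #|{: ordmap P (bcirc k.-1)}| - #|{: ordmap P (bcirc k)}|) +
   #|{: ordmap P (bcirc k)}|)%N.

Local Open Scope ring_scope.

(** Substituting p^k = C_k + delta_k, and likewise at k - 1, eliminates p and delta from both the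
    condition and the value. *)
Lemma Mcirc_setP (v : int) :
  Mcirc_set P n v <-> exists2 k, admissible k & v = (Mcirc_value k)%:Z.
Proof.
suff E k : (2 <= k)%N ->
  ((nfilters P)%:Z ^+ k.-1 * ((nfilters P)%:Z - 1) - (delta P k)%:Z
     + (delta P k.-1)%:Z <= n%:Z) = admissible k /\
  (admissible k ->
   k%:Z * n%:Z - (nfilters P)%:Z ^+ k.-1 *
       (k%:Z * ((nfilters P)%:Z - 1) - (nfilters P)%:Z)
     + (k%:Z - 1) * (delta P k)%:Z - k%:Z * (delta P k.-1)%:Z =
   (Mcirc_value k)%:Z).
  split=> [[k [k2 kn ->]]|[k ak ->]]; have [|] // := E k.
  - by move=> adm val; rewrite adm in kn; exists k => //; apply: val.
  - by case/andP: ak.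
  - move=> adm val; exists k.
    by split; [case/andP: ak | rewrite adm | rewrite val].
move=> k2.
have pX m : (nfilters P)%:Z ^+ m = (nfilters P ^ m)%N.
  by rewrite -natz -[RHS]natz natrX.
have pk : (nfilters P)%:Z ^+ k.-1 =
    #|{: ordmap P (bcirc k.-1)}|%:Z + (delta P k.-1)%:Z.
  by rewrite -PoszD card_ordmap_bcirc pX.
have dk : (delta P k)%:Z = (nfilters P)%:Z * (nfilters P)%:Z ^+ k.-1
    - #|{: ordmap P (bcirc k)}|%:Z.
  rewrite -exprS prednK ?(ltnW k2) // pX -card_ordmap_bcirc PoszD.
  by rewrite addrC addKr.
rewrite dk pk /admissible k2 /Mcirc_value; split.
  rewrite -lez_nat PoszD; apply/idP/idP; lia.
by move=> kn; rewrite PoszD PoszM -subzn // PoszD; ring.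
Qed.

(** D_k >= k by the constant maps, so the maximum runs over finitely many [k]. *)
Lemma admissible_le (k : nat) : (0 < #|P|)%N -> admissible k -> (k <= n)%N.
Proof.
move=> P0 /andP[k2].
pose i0 : 'I_k := Ordinal (leq_trans (isT : (0 < 2)%N) k2).
rewrite -(card_ordmap_not_above P i0) leq_add2r.
exact/leq_trans/leq_card_ordmap_not_above.
Qed.

End MaximizedSet.

(** * Existence of the maximum, the bound and its attainment *)

Local Open Scope ring_scope.

Theorem theorem4p10p4 (dP : Order.disp_t) (P : finPOrderType dP) (n : nat) :
  (0 < #|P|)%N -> (1 <= n)%N ->
  exists M : int,
    [/\ is_Mcirc P n M,
        forall (dL : Order.disp_t) (L : finMeetSemilatticeType dL)
               (alpha : ordmap P L -> nat),
          multi_semilattice alpha ->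
          no_greatest L ->
          (forall a : L, join_irreducible a ->
             (multi_card alpha
                ([set: ordmap P L] :\: maps_into P (upper a)) <= n)%N) ->
          (multi_card alpha [set: ordmap P L])%:Z <= M
      & (exists v : int, Mcirc_set P n v) ->
        exists (dL : Order.disp_t) (L : finMeetSemilatticeType dL)
               (alpha : ordmap P L -> nat),
          [/\ multi_semilattice alpha,
              no_greatest L,
              forall a : L, join_irreducible a ->
                (multi_card alpha
                   ([set: ordmap P L] :\: maps_into P (upper a)) <= n)%N
            & (multi_card alpha [set: ordmap P L])%:Z = M]].
Proof.
move=> P0 _.
(* Admissible indices are at most [n], so a search in ['I_n.+1] decides whether the maximized set is
   empty. *)
have [[k0 adm0]|noadm] : (exists k : 'I_n.+1, admissible P n k) \/
    forall k, ~~ admissible P n k.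
  have [/existsP|/existsPn H] := boolP [exists k : 'I_n.+1, admissible P n k].
    by left.
  right=> k; apply/negP => adm; have kn := admissible_le P0 adm.
  by case/negP: (H (Ordinal (kn : (k < n.+1)%N))).
- case: (@arg_maxnP _ k0 (fun k : 'I_n.+1 => admissible P n k)
    (fun k : 'I_n.+1 => Mcirc_value P n k) adm0) => m adm maxm.
  have maxM k : admissible P n k -> (Mcirc_value P n k <= Mcirc_value P n m)%N.
    move=> admk; have kn := admissible_le P0 admk.
    exact: (maxm (Ordinal (kn : (k < n.+1)%N))).
  exists (Mcirc_value P n m)%:Z; split.
  + left; split=> [|v /Mcirc_setP [k admk ->]]; last by rewrite lez_nat maxM.
    by apply/Mcirc_setP; exists (val m).
  + move=> dL L alpha alpha0 noT alpha_le; rewrite lez_nat.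
    (* [no_greatest] allows [L] to be empty; then L^P is empty too, as [P] has a point, and the
       total is 0. *)
    have [L0|L0] := posnP #|L|; last first.
      have [k [k2 kn kM]] := multi_card_le P0 alpha0 noT alpha_le L0.
      by apply: (leq_trans kM); apply: maxM; rewrite /admissible k2 kn.
    rewrite /multi_card big1 // => f _; have /card_gt0P [x _] := P0.
    by have := card0_eq L0 (f x); rewrite inE.
  + move=> _; case/andP: adm => m2 mn.
    (* The extra weight is n - D_m for the maximizing [m]. *)
    exists _, (bcirc m), (@coatom_weight _ P m
      (n + #|{: ordmap P (bcirc m.-1)}| - #|{: ordmap P (bcirc m)}|)); split.
    * by move=> f.
    * exact: bcirc_no_greatest.
    * by move=> A; apply: multi_card_coatom_weight_le => //; rewrite subnKC.
    * by rewrite multi_card_coatom_weightT.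
- exists 0; split.
  + right; split=> // v /Mcirc_setP [k admk _].
    by case/negP: (noadm k).
  + move=> dL L alpha alpha0 noT alpha_le; rewrite lez_nat.
    (* A non-empty [L] would yield an admissible [k], so only the empty [L] remains, with total
       0. *)
    have [L0|L0] := posnP #|L|; last first.
      have [k [k2 kn _]] := multi_card_le P0 alpha0 noT alpha_le L0.
      by case/negP: (noadm k); rewrite /admissible k2 kn.
    rewrite /multi_card big1 // => f _; have /card_gt0P [x _] := P0.
    by have := card0_eq L0 (f x); rewrite inE.
  + by move=> [v /Mcirc_setP [k admk _]]; case/negP: (noadm k).
Qed.
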